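(* Let $0<a<b$ be real numbers. The following hold. (1) If $0<y\leq 1$, then $$\left(\frac{b+y}{a+y}\right)^{1-y}\left(\frac{a}{b}\right)\leq\frac{B(b,y)}{B(a,y)}\leq \left(\frac{a}{b}\right)^{y}.$$ (2) If $y>1$, then $$\left(\frac{a}{b}\right)^{y}\leq\frac{B(b,y)}{B(a,y)}\leq \left(\frac{b+y}{a+y}\right)^{1-y}\left(\frac{a}{b}\right).$$
   Context: For real $x,y>0$, $B(x,y)=\int_0^1 t^{x-1}(1-t)^{y-1}\,dt$ denotes the (Euler) beta function. *)

(* Defs.v *)
From mathcomp Require Import all_boot all_order all_algebra.
From mathcomp Require Import all_classical all_reals all_analysis.

Set Implicit Arguments.
Unset Strict Implicit.
Unset Printing Implicit Defensive.

Import Order.TTheory GRing.Theory Num.Theory.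
Import numFieldNormedType.Exports.

Local Open Scope classical_set_scope.
Local Open Scope ring_scope.

(* The library's [beta_fun] only takes natural arguments; this is the beta
   function at real arguments.  It is meant for 0 < x and 0 < y, where the
   integrand is Lebesgue-integrable on [0, 1].  When x < 1 or y < 1 the
   integrand is unbounded near an endpoint; [powR] gives it the value 0 at
   that endpoint, which has measure zero. *)
Definition euler_beta (R : realType) (x y : R) : R :=
  \int[@lebesgue_measure R]_(t in `[0, 1])
    (t `^ (x - 1) * (1 - t) `^ (y - 1)).

(* Main.v *)
(* Put c = a / b. Substituting t = s^c in B(b, y) gives
   c * int_0^1 s^(a-1) (1 - s^c)^(y-1) ds, and Bernoulli's inequality
   1 - s^c >= c (1 - s) compares it with c^y B(a, y), the sign of y - 1 deciding
   the direction.
   For the other bound, put d = (a + y) / (b + y) and substitute t = s^d in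
   B(b+1, y): the integrand is d s^a ((1 - s^d) s^(1-d))^(y-1), and Bernoulli
   with exponent 1 - d gives (1 - s^d) s^(1-d) <= d (1 - s), which compares it
   with d^y B(a+1, y). The recurrence x B(x, y) = (x + y) B(x+1, y) brings the
   arguments back to a and b. *)
Require Import Defs.
From mathcomp Require Import all_boot all_order all_algebra.
From mathcomp Require Import all_classical all_reals all_analysis.
From mathcomp Require Import measurable_realfun ring lra.

Set Implicit Arguments.
Unset Strict Implicit.
Unset Printing Implicit Defensive.

Import Order.TTheory GRing.Theory Num.Theory.
Import numFieldNormedType.Exports.

Local Open Scope classical_set_scope.
Local Open Scope ring_scope.

(** * Integrals over an open interval as limits over compact subintervals *)

Lemma ge0_cvg_integral_itvoo (R : realType) (f : R -> R) (a b : R)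
    (u v : R^nat) :
  nonincreasing_seq u -> nondecreasing_seq v ->
  (forall n, a < u n) -> (forall n, v n < b) ->
  u @ \oo --> a -> v @ \oo --> b ->
  measurable_fun `]a, b[ f -> (forall x, a < x < b -> 0 <= f x) ->
  (\int[lebesgue_measure]_(x in `[u n, v n]) (f x)%:E)%E @[n --> \oo]
    --> (\int[lebesgue_measure]_(x in `]a, b[) (f x)%:E)%E.
Proof.
move=> du iv au vb cu cv mf f0.
have sub n : `[u n, v n] `<=` `]a, b[.
  move=> x /=; rewrite !in_itv/= => /andP[ux xv].
  by rewrite (lt_le_trans (au n))//= (le_lt_trans xv).
(* The intervals [[u n, v n]] grow and eventually contain each point of []a, b[], so monotone
   convergence applies to this union and no integrability is required. *)
have -> : `]a, b[%classic = \bigcup_n `[u n, v n]%classic.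
  apply/seteqP; split => [x /=|x [n _ /sub//]].
  rewrite in_itv/= => /andP[ax xb].
  have : \forall n \near \oo, u n <= x <= v n.
    near=> n; apply/andP; split; apply/ltW; near: n.
      exact: cvgr_lt cu _ ax.
    exact: cvgr_gt cv _ xb.
  by move=> [n _ /(_ n (leqnn n)) H]; exists n => //=; rewrite in_itv.
apply: ge0_nondecreasing_set_cvg_integral => //.
- move=> m n mn; rewrite subsetEset => x /=; rewrite !in_itv/= => /andP[ux xv].
  by rewrite (le_trans (du _ _ mn))// (le_trans xv)// iv.
- move=> n; apply/measurable_EFinP.
  exact: measurable_funS mf.
- move=> n x /sub/=; rewrite in_itv/= => x01; rewrite lee_fin; exact: f0.
Unshelve. all: end_near. Qed.

Lemma continuous_powR (R : realType) (r x : R) : 0 < x ->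
  {for x, continuous (fun t : R => t `^ r)}.
Proof.
move=> x0; apply: differentiable_continuous.
by apply/derivable1_diffP; apply: derivable_powR; rewrite in_itv/= andbT.
Qed.

(** Starting at 1/3 keeps every term below 1/2, so that [[cutoff R n, 1 - cutoff R n]] is a
    nondegenerate interval inside []0, 1[] for every [n]. *)
Definition cutoff (R : realType) (n : nat) : R := n.+3%:R^-1.

Lemma cutoff_gt0 (R : realType) n : 0 < cutoff R n.
Proof. by rewrite invr_gt0. Qed.

Lemma cutoff_nonincreasing (R : realType) : nonincreasing_seq (cutoff R).
Proof. by move=> m n mn; rewrite lef_pV2 ?posrE// ler_nat !ltnS. Qed.

Lemma cutoff_lt_half (R : realType) n : cutoff R n < 2^-1.
Proof. by rewrite ltf_pV2 ?posrE// ltr_nat. Qed.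

Lemma cutoff_lt1 (R : realType) n : cutoff R n < 1.
Proof. by rewrite (lt_trans (cutoff_lt_half R n))// invf_lt1// ltr1n. Qed.

Lemma cvg_cutoff (R : realType) : cutoff R @ \oo --> (0 : R).
(* [cutoff] is the harmonic sequence shifted by two. *)
Proof. by have := @cvg_harmonic R; rewrite -2!cvg_shiftS. Qed.

Lemma cvg_1Bcutoff (R : realType) : 1 - cutoff R n @[n --> \oo] --> (1 : R).
Proof.
by rewrite -[X in _ --> X]subr0; apply: cvgB; [exact: cvg_cst|exact: cvg_cutoff].
Qed.

Lemma cvg_cutoff_powR (R : realType) (r : R) : 0 < r ->
  cutoff R n `^ r @[n --> \oo] --> (0 : R).
Proof.
move=> r0; have /cvg_at_rightP/(_ (cutoff R)) := powR_cvg0 r0.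
by apply; split; [exact: cutoff_gt0|exact: cvg_cutoff].
Qed.

Lemma cvg_1Bcutoff_powR (R : realType) (r : R) :
  (1 - cutoff R n) `^ r @[n --> \oo] --> (1 : R).
Proof.
suff : (1 - cutoff R n) `^ r @[n --> \oo] --> (1 : R) `^ r by rewrite powR1.
apply: (@continuous_cvg _ _ _ _ _ _ (fun x : R => x `^ r) _ _ (@cvg_1Bcutoff R)).
exact: continuous_powR.
Qed.

(** * The change of variable given by a power *)

Lemma integration_by_substitution_powR (R : realType) (G : R -> R) (c p q : R) :
  0 < c -> 0 < p -> p <= q ->
  (forall x : R, p `^ c <= x <= q `^ c -> {for x, continuous G}) ->
  (\int[lebesgue_measure]_(x in `[(p `^ c)%R, (q `^ c)%R]) (G x)%:E =
   \int[lebesgue_measure]_(x in `[p, q]) (G (x `^ c) * (c * x `^ (c - 1)))%:E)%E.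
Proof.
move=> c0 p0 pq cG.
pose F := fun x : R => x `^ c.
have cF (x : R) : 0 < x -> {for x, continuous F} by exact: continuous_powR.
have dF (x : R) : 0 < x -> (F^`())%classic x = c * x `^ (c - 1).
  by move=> x0; rewrite /F powR_derive1// in_itv/= andbT.
have cF' (x : R) : 0 < x -> {for x, continuous (F^`()%classic)}.
  move=> x0; rewrite /prop_for /continuous_at dF//.
  have : c * t `^ (c - 1) @[t --> x] --> c * x `^ (c - 1).
    by apply: cvgMr; exact: continuous_powR.
  (* The formula [dF] for the derivative is known only at positive points, which is enough near
     [x > 0]. *)
  apply: cvg_trans; apply: near_eq_cvg; near=> t; rewrite dF//.
  by near: t; exact: lt_nbhsr.
have q0 : 0 < q by exact: lt_le_trans pq.
rewrite (@integration_by_substitution_increasing R F G p q)//.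
- apply: eq_integral => x; rewrite inE/= in_itv/= => /andP[px _].
  by rewrite fctE dF// (lt_le_trans p0).
- move=> x y; rewrite !in_itv/= => /andP[px _] /andP[py _] xy.
  by rewrite gt0_ltr_powR// nnegrE (le_trans (ltW p0)).
- move=> x; rewrite in_itv/= => /andP[px _]; apply: cF'.
  exact: lt_trans px.
- by apply/cvg_ex; exists (F^`()%classic p); apply: cvg_at_right_filter; exact: cF'.
- by apply/cvg_ex; exists (F^`()%classic q); apply: cvg_at_left_filter; exact: cF'.
- split.
  + move=> x; rewrite in_itv/= => /andP[px _]; apply: derivable_powR.
    by rewrite in_itv/= andbT (lt_trans p0).
  + by apply: cvg_at_right_filter; exact: cF.
  + by apply: cvg_at_left_filter; exact: cF.
- apply: continuous_in_subspaceT => x; rewrite inE/= in_itv/=; exact: cG.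
Unshelve. all: end_near. Qed.

Lemma ge0_integration_by_substitution_powR (R : realType) (G : R -> R) (c : R) :
  0 < c -> (forall x : R, 0 < x < 1 -> {for x, continuous G}) ->
  (forall x : R, 0 < x < 1 -> 0 <= G x) ->
  (\int[lebesgue_measure]_(x in `]0%R, 1%R[) (G x)%:E =
   \int[lebesgue_measure]_(x in `]0%R, 1%R[)
     (G (x `^ c) * (c * x `^ (c - 1)))%:E)%E.
Proof.
move=> c0 cG G0.
have pow01 (x : R) : 0 < x < 1 -> 0 < x `^ c < 1.
  move=> /andP[x0 x1]; rewrite powR_gt0//= -[ltRHS](congr1 (@^~ c) (powR1 R)).
  by rewrite gt0_ltr_powR// nnegrE// ltW.
have hi1 n : 0 < 1 - cutoff R n < 1 by rewrite subr_gt0 cutoff_lt1 gtrBl cutoff_gt0.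
have lohi n : cutoff R n <= 1 - cutoff R n by have := cutoff_lt_half R n; lra.
have mG : measurable_fun `]0%R, (1 : R)[ G.
  apply: open_continuous_measurable_fun => // x; rewrite inE/= in_itv/=.
  exact: cG.
have mG' : measurable_fun `]0%R, (1 : R)[
    (fun x => G (x `^ c) * (c * x `^ (c - 1))).
  apply: open_continuous_measurable_fun => // x; rewrite inE/= in_itv/= => x01.
  have x0 : 0 < x by case/andP : x01.
  apply: cvgM; last by apply: cvgMr; exact: continuous_powR.
  apply: continuous_comp; [exact: continuous_powR|exact/cG/pow01].
have hi_inc : nondecreasing_seq (fun n => 1 - cutoff R n).
  by move=> m n mn; rewrite lerB// cutoff_nonincreasing.
have le_pow (x y : R) : 0 < x -> x <= y -> x `^ c <= y `^ c.
  move=> x0 xy; apply: ge0_ler_powR => //; rewrite ?nnegrE ?(ltW c0) ?(ltW x0)//.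
  by rewrite (le_trans (ltW x0)).
have lim1 : (\int[lebesgue_measure]_(x in `[(cutoff R n `^ c)%R, ((1 - cutoff R n) `^ c)%R])
    (G x)%:E)%E @[n --> \oo] --> (\int[lebesgue_measure]_(x in `]0%R, 1%R[) (G x)%:E)%E.
  apply: ge0_cvg_integral_itvoo => //.
  - by move=> m n mn; apply: le_pow => //; [exact: cutoff_gt0|exact: cutoff_nonincreasing].
  - by move=> m n mn; apply: le_pow; [case/andP : (hi1 m)|exact: hi_inc].
  - by move=> n; rewrite powR_gt0// cutoff_gt0.
  - by move=> n; case/andP : (pow01 _ (hi1 n)).
  - exact: cvg_cutoff_powR.
  - exact: cvg_1Bcutoff_powR.
have lim2 : (\int[lebesgue_measure]_(x in `[cutoff R n, (1 - cutoff R n)%R])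
    (G (x `^ c) * (c * x `^ (c - 1)))%:E)%E @[n --> \oo] -->
    (\int[lebesgue_measure]_(x in `]0%R, 1%R[) (G (x `^ c) * (c * x `^ (c - 1)))%:E)%E.
  apply: ge0_cvg_integral_itvoo => //.
  - exact: cutoff_nonincreasing.
  - exact: cutoff_gt0.
  - by move=> n; case/andP : (hi1 n).
  - exact: cvg_cutoff.
  - exact: cvg_1Bcutoff.
  - move=> x x01; apply: mulr_ge0; first exact/G0/pow01.
    by rewrite mulr_ge0 ?powR_ge0// ltW.
apply: (@cvg_unique _ (@ereal_hausdorff R) _ _ _ _ lim1 _) => /=.
move: lim2; apply: cvg_trans.
apply: near_eq_cvg; near=> n; rewrite integration_by_substitution_powR ?cutoff_gt0//.
move=> x /andP[x1 x2]; apply: cG.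
rewrite (lt_le_trans _ x1) ?powR_gt0 ?cutoff_gt0//=.
by apply: (le_lt_trans x2); case/andP: (pow01 _ (hi1 n)).
Unshelve. all: end_near. Qed.

(** * The beta integrand and its integral in the extended reals *)

Lemma is_derive_onem_powR (R : realType) (y t : R) : t < 1 ->
  is_derive t 1 (fun s : R => (1 - s) `^ y) (- (y * (1 - t) `^ (y - 1))).
Proof.
move=> t1; have t1' : 0 < 1 - t by rewrite subr_gt0.
have d1 : is_derive t 1 (fun s : R => 1 - s) (-1).
  by apply: is_derive_eq; rewrite add0r mul1r.
have := @is_derive1_comp R (fun s : R => s `^ y) (fun s : R => 1 - s) t _ _
  (is_derive1_powR y t1') d1.
by rewrite mulrN1.
Qed.

Lemma continuous_onem_powR (R : realType) (r t : R) : t < 1 ->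
  {for t, continuous (fun s : R => (1 - s) `^ r)}.
Proof.
move=> t1; apply: differentiable_continuous; apply/derivable1_diffP.
by case: (is_derive_onem_powR r t1).
Qed.

Definition beta_integrand (R : realType) (x y t : R) : R :=
  t `^ (x - 1) * (1 - t) `^ (y - 1).

(** Extended-real values let the recurrences and the substitution be proved before finiteness, which
    is then deduced from them. On the open interval the integrand is continuous and positive
    everywhere. *)
Definition ebeta (R : realType) (x y : R) : \bar R :=
  (\int[lebesgue_measure]_(t in `]0%R, 1%R[) (beta_integrand x y t)%:E)%E.

Lemma beta_integrand_gt0 (R : realType) (x y t : R) :
  0 < t < 1 -> 0 < beta_integrand x y t.
Proof. by move=> /andP[t0 t1]; rewrite mulr_gt0// powR_gt0// subr_gt0. Qed.

Lemma continuous_beta_integrand (R : realType) (x y t : R) : 0 < t < 1 ->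
  {for t, continuous (beta_integrand x y)}.
Proof.
move=> /andP[t0 t1].
by apply: cvgM; [exact: continuous_powR|exact: continuous_onem_powR].
Qed.

Lemma measurable_beta_integrand (R : realType) (x y : R) :
  measurable_fun `]0%R, (1 : R)[ (beta_integrand x y).
Proof.
apply: open_continuous_measurable_fun => // t; rewrite inE/= in_itv/=.
exact: continuous_beta_integrand.
Qed.

Lemma emeasurable_beta_integrand (R : realType) (x y : R) :
  measurable_fun `]0%R, (1 : R)[ (fun t => (beta_integrand x y t)%:E).
Proof. by apply/measurable_EFinP; exact: measurable_beta_integrand. Qed.

Lemma euler_betaE (R : realType) (x y : R) :
  euler_beta x y = fine (ebeta x y).
Proof.
rewrite /euler_beta /Rintegral integral_itv_bndoo//.
exact: emeasurable_beta_integrand.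
Qed.

(** A zero integral would force the integrand to vanish almost everywhere on []0, 1[], a set of
    measure 1 on which it is positive. *)
Lemma ebeta_gt0 (R : realType) (x y : R) : (0 < ebeta x y)%E.
Proof.
have b0 (t : R) : `]0, 1[%classic t -> (0 <= (beta_integrand x y t)%:E)%E.
  by rewrite /= in_itv/= => t01; rewrite lee_fin ltW// beta_integrand_gt0.
rewrite lt_neqAle integral_ge0// andbT eq_sym; apply/negP => /eqP b00.
have := @ae_eq_integral_abs _ _ R (@lebesgue_measure R) `]0%R, 1%R[%classic
  (measurable_itv _) (fun t => (beta_integrand x y t)%:E) _.
move=> [].
  exact: emeasurable_beta_integrand.
move=> + _; under eq_integral => t.
  rewrite inE => /b0 t0; rewrite gee0_abs//; over.
move=> /(_ b00) [N [mN N0 sN]].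
have : (@lebesgue_measure R `]0%R, 1%R[%classic <= lebesgue_measure N)%E.
  apply: le_measure; rewrite ?inE//.
  move=> t t01; apply: sN => /= /(_ t01) [].
  have : 0 < t < 1 by move: t01; rewrite /= in_itv.
  by move/(beta_integrand_gt0 x y)/gt_eqF/eqP.
by rewrite N0 lebesgue_measure_itv/= lte01 oppr0 adde0 lee_fin ler10.
Qed.

(** * Recurrences of the beta integral *)

Lemma powR_mulB1 (R : realType) (r t : R) : 0 < t -> t `^ r = t * t `^ (r - 1).
Proof.
move=> t0; rewrite -{2}(powRr1 (ltW t0)) -powRD ?(gt_eqF t0) ?implybT//.
by rewrite addrC subrK.
Qed.

(** Multiply the integrand by [(1 - t) + t = 1]. *)
Lemma ebetaD (R : realType) (x y : R) :
  ebeta x y = (ebeta x (y + 1) + ebeta (x + 1) y)%E.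
Proof.
rewrite /ebeta -ge0_integralD//; first last.
- exact: emeasurable_beta_integrand.
- by move=> t /=; rewrite in_itv/= => t01; rewrite lee_fin ltW// beta_integrand_gt0.
- exact: emeasurable_beta_integrand.
- by move=> t /=; rewrite in_itv/= => t01; rewrite lee_fin ltW// beta_integrand_gt0.
apply: eq_integral => t; rewrite inE/= in_itv/= => /andP[t0 t1].
rewrite -EFinD /beta_integrand !addrK; congr EFin.
rewrite (powR_mulB1 x t0) (powR_mulB1 y (_ : 0 < 1 - t)) ?subr_gt0//; ring.
Qed.

(** The primitives are [t]^ x[and]- (1 - t) [^ y]. Staying inside []0, 1[] avoids the endpoint
    singularities, at the price of an explicit boundary term. *)
Lemma beta_integrand_by_parts (R : realType) (x y p q : R) :
  0 < x -> 0 < p -> p < q -> q < 1 ->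
  (\int[lebesgue_measure]_(t in `[p, q]) (y * beta_integrand (x + 1) y t)%:E =
  (p `^ x * (1 - p) `^ y - q `^ x * (1 - q) `^ y)%:E +
  \int[lebesgue_measure]_(t in `[p, q]) (x * beta_integrand x (y + 1) t)%:E)%E.
Proof.
move=> x0 p0 pq q1.
have in01 (t : R) : t \in `[p, q] -> 0 < t < 1.
  rewrite in_itv/= => /andP[pt tq].
  by rewrite (lt_le_trans p0 pt)/= (le_lt_trans tq).
have in01' (t : R) : t \in `]p, q[ -> 0 < t < 1.
  by move=> tn; apply: in01; exact: subset_itv_oo_cc.
have p01 : 0 < p < 1 by rewrite p0 (lt_trans pq).
have q01 : 0 < q < 1 by rewrite q1 (lt_trans p0).
have cpow (r t : R) : 0 < t < 1 -> {for t, continuous (fun t : R => t `^ r)}.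
  by move=> /andP[t0 _]; exact: continuous_powR.
have c1pow (r t : R) : 0 < t < 1 -> {for t, continuous (fun t : R => (1 - t) `^ r)}.
  by move=> /andP[_ t1]; exact: continuous_onem_powR.
have dG (t : R) : 0 < t < 1 ->
    is_derive t 1 (fun s : R => - (1 - s) `^ y) (y * (1 - t) `^ (y - 1)).
  move=> /andP[_ t1]; rewrite -[X in is_derive _ _ _ X]opprK.
  exact: is_deriveN (is_derive_onem_powR y t1).
have dF (t : R) : 0 < t < 1 ->
    is_derive t 1 (fun s : R => s `^ x) (x * t `^ (x - 1)).
  by move=> /andP[t0 _]; exact: is_derive1_powR.
have := @integration_by_parts R (fun t => t `^ x) (fun t => - (1 - t) `^ y)
  (fun t => x * t `^ (x - 1)) (fun t => y * (1 - t) `^ (y - 1)) p q pq.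
under eq_integral => t _.
  rewrite mulrCA (_ : t `^ x * _ = beta_integrand (x + 1) y t); last first.
    by rewrite /beta_integrand addrK.
  over.
move=> -> //.
- rewrite !mulrN opprK [(- (q `^ x * _) + _)%R]addrC; congr (_ + _)%E.
  (* The remaining integrand is nonpositive; its sign comes out of the integral because its opposite
     is nonnegative, without integrability. *)
  apply: (canLR oppeK); rewrite -integral_ge0N; last first.
    move=> t /in01 /andP[t0 t1]; rewrite lee_fin.
    by rewrite mulr_ge0 ?(ltW x0)// ltW// beta_integrand_gt0// t0 t1.
  apply: eq_integral => t _; rewrite -EFinN; congr EFin.
  by rewrite /beta_integrand addrK; ring.
- apply: continuous_in_subspaceT => t /[!inE]/= /in01 t01.
  by apply: cvgMr; exact: cpow.
- split.
  + by move=> t /in01' /dF[].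
  + by apply: cvg_at_right_filter; exact: cpow.
  + by apply: cvg_at_left_filter; exact: cpow.
- by move=> t /in01' /dF[_ <-]; rewrite derive1E.
- apply: continuous_in_subspaceT => t /[!inE]/= /in01 t01.
  by apply: cvgMr; exact: c1pow.
- split.
  + by move=> t /in01' /dG[].
  + by apply: cvg_at_right_filter; apply: cvgN; exact: c1pow.
  + by apply: cvg_at_left_filter; apply: cvgN; exact: c1pow.
- by move=> t /in01' /dG[_ <-]; rewrite derive1E.
Qed.

(** Let the endpoints in [beta_integrand_by_parts] tend to 0 and 1: since [x] and [y] are positive,
    the boundary term vanishes. *)
Lemma ebeta_by_parts (R : realType) (x y : R) : 0 < x -> 0 < y ->
  (x%:E * ebeta x (y + 1) = y%:E * ebeta (x + 1) y)%E.
Proof.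
move=> x0 y0.
have lim k u v : 0 <= k ->
  (\int[lebesgue_measure]_(t in `[cutoff R n, (1 - cutoff R n)%R])
    (k * beta_integrand u v t)%:E)%E @[n --> \oo] --> (k%:E * ebeta u v)%E.
  move=> k0; rewrite /ebeta -ge0_integralZl//; first last.
  - by move=> t /=; rewrite in_itv/= => t01; rewrite lee_fin ltW// beta_integrand_gt0.
  - exact: emeasurable_beta_integrand.
  apply: ge0_cvg_integral_itvoo => //.
  - exact: cutoff_nonincreasing.
  - by move=> m n mn; rewrite lerB// cutoff_nonincreasing.
  - exact: cutoff_gt0.
  - by move=> n; rewrite gtrBl cutoff_gt0.
  - exact: cvg_cutoff.
  - exact: cvg_1Bcutoff.
  - apply: measurable_funM => //; exact: measurable_beta_integrand.
  - by move=> t t01; rewrite mulr_ge0// ltW// beta_integrand_gt0.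
pose B n := cutoff R n `^ x * (1 - cutoff R n) `^ y -
  (1 - cutoff R n) `^ x * (1 - (1 - cutoff R n)) `^ y.
have limB : (B n)%:E @[n --> \oo] --> 0%E.
  apply: cvg_EFin; first exact: nearW.
  rewrite -[X in _ --> X](subrr (0 : R)) -[X in _ --> X - _](mul0r 1).
  rewrite -[X in _ --> _ - X](mulr0 1).
  apply: cvgB; apply: cvgM;
    [exact: cvg_cutoff_powR|exact: cvg_1Bcutoff_powR|exact: cvg_1Bcutoff_powR|].
  under eq_fun do rewrite subKr; exact: cvg_cutoff_powR.
apply/esym/(@cvg_unique _ (@ereal_hausdorff R) _ _ _ _ (lim y _ _ (ltW y0)) _) => /=.
(* The limit of the sum is legitimate even if the beta integral is infinite, because the boundary
   term has the finite limit 0. *)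
have D0 : (0 +? (x%:E * ebeta x (y + 1)))%E by rewrite fin_num_adde_defr.
have := cvgeD D0 limB (lim x x (y + 1) (ltW x0)).
move=> /(_ eventually_filter); rewrite add0e; apply: cvg_trans.
apply: near_eq_cvg; near=> n.
apply/esym/beta_integrand_by_parts; rewrite ?gtrBl ?cutoff_gt0//.
by have := cutoff_lt_half R n; lra.
Unshelve. all: end_near. Qed.

(** * Power substitution in the beta integral, and finiteness *)

Lemma ebeta_substitution (R : realType) (x y c : R) : 0 < c ->
  ebeta x y = (\int[lebesgue_measure]_(s in `]0%R, 1%R[)
    (c * s `^ (c * x - 1) * (1 - s `^ c) `^ (y - 1))%:E)%E.
Proof.
move=> c0; rewrite /ebeta (@ge0_integration_by_substitution_powR _ _ c)//.
- apply: eq_integral => s; rewrite inE/= in_itv/= => /andP[s0 s1].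
  rewrite /beta_integrand -powRrM; congr EFin.
  (* The first factor of the integrand contributes [c * (x - 1)] to the exponent of [s], the
     derivative of the substitution [c - 1]. *)
  rewrite (_ : c * x - 1 = c * (x - 1) + (c - 1)); last by ring.
  rewrite (@powRD _ s (c * (x - 1))) ?(gt_eqF s0) ?implybT//; ring.
- exact: continuous_beta_integrand.
- by move=> t t01; rewrite ltW// beta_integrand_gt0.
Qed.

Lemma ebeta_ge0 (R : realType) (x y : R) : (0 <= ebeta x y)%E.
Proof. exact/ltW/ebeta_gt0. Qed.

(** Substituting with exponent [x^-1] turns the integrand into the constant [x^-1]. *)
Lemma ebeta1 (R : realType) (x : R) : 0 < x -> ebeta x 1 = (x^-1)%:E.
Proof.
move=> x0; rewrite (@ebeta_substitution _ _ _ x^-1) ?invr_gt0//.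
under eq_integral => s _ do rewrite mulVf ?gt_eqF// !subrr !powRr0 !mulr1.
rewrite integral_cst//= lebesgue_measure_itv/= lte01 oppr0 adde0 mule1//.
Qed.

Lemma ebeta_fin_num (R : realType) (x y : R) : 0 < x -> 0 < y ->
  ebeta x y \is a fin_num.
Proof.
move=> x0 y0.
have fy1 : ebeta x (y + 1) \is a fin_num.
  rewrite ge0_fin_numE ?ebeta_ge0//.
  apply: (@le_lt_trans _ _ (ebeta x 1)); last by rewrite ebeta1// ltry.
  apply: ge0_le_integral => //.
  - by move=> t /=; rewrite in_itv/= => t01; rewrite lee_fin ltW// beta_integrand_gt0.
  - exact: emeasurable_beta_integrand.
  - exact: emeasurable_beta_integrand.
  move=> t /=; rewrite in_itv/= => /andP[t0 t1]; rewrite lee_fin.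
  rewrite /beta_integrand ler_pM2l ?powR_gt0//; apply: ger_powR.
    by rewrite subr_gt0 t1 gerBl ltW.
  by rewrite subrr addrK ltW.
rewrite ebetaD fin_numD fy1/= ge0_fin_numE ?ebeta_ge0// ltey.
(* An infinite [ebeta (x + 1) y] would make the finite left side of [ebeta_by_parts] equal to
   [+oo]. *)
apply/eqP => xy1; have := ebeta_by_parts x0 y0.
rewrite xy1 gt0_muley ?lte_fin// -(fineK fy1).
by [].
Qed.

Lemma euler_beta_gt0 (R : realType) (x y : R) : 0 < x -> 0 < y ->
  0 < euler_beta x y.
Proof.
move=> x0 y0; rewrite euler_betaE fine_gt0// ebeta_gt0/=.
by rewrite -ge0_fin_numE ?ebeta_ge0// ebeta_fin_num.
Qed.

Lemma EFin_euler_beta (R : realType) (x y : R) : 0 < x -> 0 < y ->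
  (euler_beta x y)%:E = ebeta x y.
Proof. by move=> x0 y0; rewrite euler_betaE fineK// ebeta_fin_num. Qed.

(** Multiply [ebetaD] by [x] and replace [x B(x, y + 1)] by [y B(x + 1, y)], using
    [ebeta_by_parts]. *)
Lemma euler_betaDl (R : realType) (x y : R) : 0 < x -> 0 < y ->
  x * euler_beta x y = (x + y) * euler_beta (x + 1) y.
Proof.
move=> x0 y0.
have x1 : 0 < x + 1 by rewrite addr_gt0.
have y1 : 0 < y + 1 by rewrite addr_gt0.
have := ebetaD x y; have := ebeta_by_parts x0 y0.
rewrite -!EFin_euler_beta// => -[parts] [->].
by rewrite mulrDr parts; ring.
Qed.

(** * Bernoulli's inequality and the pointwise comparison of integrands *)

Lemma bernoulli_powR (R : realType) (c s : R) : 0 < c < 1 -> 0 <= s ->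
  s `^ c <= 1 - c * (1 - s).
Proof.
move=> /andP[c0 c1] s0; have c1' : 0 < 1 - c by rewrite subr_gt0.
(* Young's inequality for [s]^ c[and 1 with conjugate exponents]1 / c[and]1 / (1 - c)[gives]s
   [^ c <= c * s + (1 - c)]. *)
have := @conjugate_powR R (s `^ c) 1 c^-1 (1 - c)^-1 (powR_ge0 _ _) ler01.
rewrite !invr_gt0 !invrK -powRrM divff ?gt_eqF// powRr1// powR1 => /(_ c0 c1').
by rewrite subrKC => /(_ erefl); rewrite mulr1 => /le_trans; apply; lra.
Qed.

Lemma ler_powR_nonpos (R : realType) (r u v : R) :
  r <= 0 -> 0 < u -> u <= v -> v `^ r <= u `^ r.
Proof.
move=> r0 u0 uv; have v0 := lt_le_trans u0 uv.
rewrite -[r]opprK !(powRN _ (- r)) lef_pV2 ?posrE ?powR_gt0//.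
by apply: ge0_ler_powR => //; rewrite ?oppr_ge0 ?nnegrE// ltW.
Qed.

Lemma emeasurable_beta_substitution (R : realType) (x y c : R) : 0 < c ->
  measurable_fun `]0%R, (1 : R)[
    (fun s => (c * s `^ (c * x - 1) * (1 - s `^ c) `^ (y - 1))%:E).
Proof.
move=> c0; apply/measurable_EFinP; apply: measurable_funM.
  apply: measurable_funM => //.
  by apply: measurable_funTS; exact: measurable_powR.
apply: (@measurableT_comp _ _ _ _ _ _ (fun u : R => u `^ (y - 1)) _ (fun s : R => 1 - s `^ c)).
  exact: measurable_powR.
apply: measurable_funB => //.
by apply: measurable_funTS; exact: measurable_powR.
Qed.

(** Only the integral at [x] is substituted; the one at [x'] keeps its variable, so the comparison
    becomes pointwise in [s]. *)
Lemma le_euler_beta_substitution (R : realType) (x x' y c k : R) :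
  0 < x -> 0 < x' -> 0 < y -> 0 < c -> 0 <= k ->
  (forall s, 0 < s < 1 ->
    c * s `^ (c * x - 1) * (1 - s `^ c) `^ (y - 1) <= k * beta_integrand x' y s) ->
  euler_beta x y <= k * euler_beta x' y.
Proof.
move=> x0 x'0 y0 c0 k0 le_k.
rewrite -lee_fin EFinM !EFin_euler_beta// (ebeta_substitution _ _ c0).
rewrite /ebeta -ge0_integralZl//; first last.
- by move=> s /=; rewrite in_itv/= => s01; rewrite lee_fin ltW// beta_integrand_gt0.
- exact: emeasurable_beta_integrand.
apply: ge0_le_integral => //.
- move=> s _; rewrite lee_fin !mulr_ge0 ?powR_ge0// ltW//.
- exact: emeasurable_beta_substitution.
- apply: measurable_funeM; exact: emeasurable_beta_integrand.
Qed.

Lemma ge_euler_beta_substitution (R : realType) (x x' y c k : R) :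
  0 < x -> 0 < x' -> 0 < y -> 0 < c -> 0 <= k ->
  (forall s, 0 < s < 1 ->
    k * beta_integrand x' y s <= c * s `^ (c * x - 1) * (1 - s `^ c) `^ (y - 1)) ->
  k * euler_beta x' y <= euler_beta x y.
Proof.
move=> x0 x'0 y0 c0 k0 le_k.
rewrite -lee_fin EFinM !EFin_euler_beta// (ebeta_substitution x y c0).
rewrite /ebeta -ge0_integralZl//; first last.
- by move=> s /=; rewrite in_itv/= => s01; rewrite lee_fin ltW// beta_integrand_gt0.
- exact: emeasurable_beta_integrand.
apply: ge0_le_integral => //.
- move=> s /=; rewrite in_itv/= => s01.
  by rewrite -EFinM lee_fin mulr_ge0// ltW// beta_integrand_gt0.
- apply: measurable_funeM; exact: emeasurable_beta_integrand.
- exact: emeasurable_beta_substitution.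
Qed.

Section comparison.
Variables (R : realType) (c s : R).
Hypotheses (c01 : 0 < c < 1) (s01 : 0 < s < 1).

Let c0 : 0 < c. Proof. by case/andP : c01. Qed.
Let s0 : 0 < s. Proof. by case/andP : s01. Qed.
Let s1 : 0 < 1 - s. Proof. by rewrite subr_gt0; case/andP : s01. Qed.

Lemma onem_powR_ge : c * (1 - s) <= 1 - s `^ c.
Proof. by have := bernoulli_powR c01 (ltW s0); lra. Qed.

Lemma onem_powR_le : (1 - s `^ c) * s `^ (1 - c) <= c * (1 - s).
Proof.
have c01' : 0 < 1 - c < 1 by move: c01; lra.
have := bernoulli_powR c01' (ltW s0).
rewrite [(1 - s `^ c) * _]mulrBl mul1r -powRD ?(gt_eqF s0) ?implybT// subrKC powRr1 ?(ltW s0)//.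
lra.
Qed.

Lemma onem_powR_gt0 : 0 < 1 - s `^ c.
Proof. by apply: lt_le_trans onem_powR_ge; rewrite mulr_gt0. Qed.

Lemma beta_integrand_scaled (x y : R) :
  c `^ y * beta_integrand x y s =
  c * s `^ (x - 1) * (c * (1 - s)) `^ (y - 1).
Proof.
rewrite powRM ?(ltW c0) ?(ltW s1)// (powR_mulB1 y c0) /beta_integrand; ring.
Qed.

(** The relation on [c] is exactly the matching of exponents
    [c * (b + 1) - 1 = a + (1 - c) * (y - 1)]; the surplus power of [s] is absorbed into the base
    raised to [y - 1]. *)
Lemma beta_substitution_shift (a b y : R) : c * (b + y) = a + y ->
  c * s `^ (c * (b + 1) - 1) * (1 - s `^ c) `^ (y - 1) =
  c * s `^ (a + 1 - 1) * ((1 - s `^ c) * s `^ (1 - c)) `^ (y - 1).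
Proof.
move=> cby.
rewrite powRM ?powR_ge0 ?(ltW onem_powR_gt0)// -powRrM.
rewrite (_ : c * (b + 1) - 1 = (a + 1 - 1) + (1 - c) * (y - 1)).
  by rewrite (@powRD _ s (a + 1 - 1)) ?(gt_eqF s0) ?implybT//; ring.
have -> : c * (b + 1) - 1 = c * (b + y) + c * (1 - y) - 1 by ring.
by rewrite cby; ring.
Qed.

End comparison.

(** * Scaling and shift inequalities for the beta function *)

Lemma euler_beta_scale_le (R : realType) (b c y : R) : 0 < b -> 0 < c < 1 ->
  0 < y <= 1 -> euler_beta b y <= c `^ y * euler_beta (c * b) y.
Proof.
move=> b0 c01 /andP[y0 y1]; have [c0 _] := andP c01.
apply: (@le_euler_beta_substitution _ _ _ _ c); rewrite ?mulr_gt0 ?powR_ge0//.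
move=> s s01; rewrite beta_integrand_scaled//.
rewrite ler_pM2l ?mulr_gt0 ?powR_gt0//; [|by case/andP : s01..].
(* The exponent [y - 1] is nonpositive, so the power reverses Bernoulli's inequality. *)
apply: ler_powR_nonpos; rewrite ?subr_le0 ?onem_powR_ge//.
by rewrite mulr_gt0// subr_gt0; case/andP : s01.
Qed.

Lemma euler_beta_scale_ge (R : realType) (b c y : R) : 0 < b -> 0 < c < 1 ->
  1 <= y -> c `^ y * euler_beta (c * b) y <= euler_beta b y.
Proof.
move=> b0 c01 y1; have [c0 _] := andP c01.
have y0 : 0 < y by exact: lt_le_trans y1.
apply: (@ge_euler_beta_substitution _ _ _ _ c); rewrite ?mulr_gt0 ?powR_ge0//.
move=> s s01; rewrite beta_integrand_scaled//.
have s0 : 0 < s by case/andP : s01.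
have s1 : 0 < 1 - s by rewrite subr_gt0; case/andP : s01.
rewrite ler_pM2l ?mulr_gt0 ?powR_gt0//.
apply: ge0_ler_powR; rewrite ?nnegrE ?subr_ge0 ?onem_powR_ge//.
  by rewrite mulr_ge0// ltW.
by rewrite -subr_ge0 ltW// onem_powR_gt0.
Qed.

(** Why [b + 1]: at [b] itself the exponents would match only when [c * (b + y - 1) = a + y - 1],
    whose right side can be nonpositive for [y < 1]. After the shift [c] is the positive ratio
    [(a + y) / (b + y)]. *)
Lemma euler_beta_shift_ge (R : realType) (a b c y : R) : 0 < a -> 0 < b ->
  0 < c < 1 -> c * (b + y) = a + y -> 0 < y <= 1 ->
  c `^ y * euler_beta (a + 1) y <= euler_beta (b + 1) y.
Proof.
move=> a0 b0 c01 cby /andP[y0 y1]; have [c0 _] := andP c01.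
apply: (@ge_euler_beta_substitution _ _ _ _ c); rewrite ?addr_gt0 ?powR_ge0//.
move=> s s01; rewrite beta_integrand_scaled// (beta_substitution_shift _ _ cby)//.
have s0 : 0 < s by case/andP : s01.
rewrite ler_pM2l ?mulr_gt0 ?powR_gt0//.
apply: ler_powR_nonpos; rewrite ?subr_le0 ?onem_powR_le//.
by rewrite mulr_gt0 ?onem_powR_gt0 ?powR_gt0.
Qed.

Lemma euler_beta_shift_le (R : realType) (a b c y : R) : 0 < a -> 0 < b ->
  0 < c < 1 -> c * (b + y) = a + y -> 1 <= y ->
  euler_beta (b + 1) y <= c `^ y * euler_beta (a + 1) y.
Proof.
move=> a0 b0 c01 cby y1; have [c0 _] := andP c01.
have y0 : 0 < y by exact: lt_le_trans y1.
apply: (@le_euler_beta_substitution _ _ _ _ c); rewrite ?addr_gt0 ?powR_ge0//.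
move=> s s01; rewrite beta_integrand_scaled// (beta_substitution_shift _ _ cby)//.
have s0 : 0 < s by case/andP : s01.
have s1 : 0 < 1 - s by rewrite subr_gt0; case/andP : s01.
rewrite ler_pM2l ?mulr_gt0 ?powR_gt0//.
apply: ge0_ler_powR; rewrite ?nnegrE ?subr_ge0 ?onem_powR_le//.
  by rewrite mulr_ge0 ?powR_ge0// ltW// onem_powR_gt0.
by rewrite mulr_ge0// ltW.
Qed.

(** With [d = (a + y) / (b + y)], the recurrence at [a] reduces the claim to [d]^ (y - 1) * (a + y)
    / b = (b + y) / b * d [^ y]. The prefactor [(b + y) / b] is the one that the recurrence gives
    for [B(b, y)]. *)
Lemma shift_ratioE (R : realType) (a b y : R) : 0 < a -> 0 < b -> 0 < y ->
  ((b + y) / (a + y)) `^ (1 - y) * (a / b) * euler_beta a y =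
  (b + y) / b * (((a + y) / (b + y)) `^ y * euler_beta (a + 1) y).
Proof.
move=> a0 b0 y0.
have ay0 : 0 < a + y by rewrite addr_gt0.
have by0 : 0 < b + y by rewrite addr_gt0.
have d0 : 0 < (a + y) / (b + y) by rewrite divr_gt0.
have -> : euler_beta a y = (a + y) / a * euler_beta (a + 1) y.
  by rewrite mulrAC -(euler_betaDl a0 y0) mulrAC divff ?mul1r// gt_eqF.
have -> : ((b + y) / (a + y)) `^ (1 - y) = ((a + y) / (b + y)) `^ (y - 1).
  rewrite -(opprB y) powRN -[in LHS](invf_div (a + y)) -powRN.
  by rewrite -[in LHS]powR_inv1 ?(ltW d0)// -powRrM mulN1r opprK.
rewrite (powR_mulB1 y d0); field.
by rewrite !gt_eqF.
Qed.

Unset Implicit Arguments.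

Theorem theorem2p2 (R : realType) (a b : R) (ha : 0 < a) (hab : a < b) :
  (forall y : R, 0 < y <= 1 ->
    ((b + y) / (a + y)) `^ (1 - y) * (a / b)
      <= euler_beta b y / euler_beta a y
      <= (a / b) `^ y)
  /\
  (forall y : R, 1 < y ->
    (a / b) `^ y
      <= euler_beta b y / euler_beta a y
      <= ((b + y) / (a + y)) `^ (1 - y) * (a / b)).
Proof.
have b0 : 0 < b by exact: lt_trans hab.
have c01 : 0 < a / b < 1 by rewrite divr_gt0//= ltr_pdivrMr// mul1r.
have cb : a / b * b = a by rewrite divfK// gt_eqF.
have d01 (y : R) : 0 < y -> 0 < (a + y) / (b + y) < 1.
  by move=> y0; rewrite divr_gt0 ?addr_gt0//= ltr_pdivrMr ?addr_gt0// mul1r ltrD2r.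
have dby (y : R) : 0 < y -> (a + y) / (b + y) * (b + y) = a + y.
  by move=> y0; rewrite divfK// gt_eqF// addr_gt0.
have recb (y : R) : 0 < y ->
    euler_beta b y = (b + y) / b * euler_beta (b + 1) y.
  by move=> y0; rewrite mulrAC -(euler_betaDl b0 y0) mulrAC divff ?mul1r// gt_eqF.
have k0 (y : R) : 0 < y -> 0 < (b + y) / b by move=> y0; rewrite divr_gt0 ?addr_gt0.
split=> y.
- move=> y01; have y0 : 0 < y by case/andP : y01.
  rewrite ler_pdivlMr ?ler_pdivrMr ?euler_beta_gt0//; apply/andP; split.
  (* Both sides now carry the positive factor [(b + y) / b]; cancelling it leaves the shift
     inequality. *)
  + rewrite (shift_ratioE ha b0 y0) (recb _ y0) ler_pM2l ?k0//.
    exact: euler_beta_shift_ge (d01 _ y0) (dby _ y0) y01.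
  + by have := euler_beta_scale_le b0 c01 y01; rewrite cb.
- move=> y1; have y0 : 0 < y by exact: lt_trans y1.
  rewrite ler_pdivlMr ?ler_pdivrMr ?euler_beta_gt0//; apply/andP; split.
  + by have := euler_beta_scale_ge b0 c01 (ltW y1); rewrite cb.
  + rewrite (shift_ratioE ha b0 y0) (recb _ y0) ler_pM2l ?k0//.
    exact: euler_beta_shift_le (d01 _ y0) (dby _ y0) (ltW y1).
Qed.
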